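(* Let $R$ be a commutative ring with non-zero identity and $I$ a proper ideal of $R$. The following statements are equivalent: (1) $I$ is a weakly $J$-ideal of $R$. (2) $I\subseteq J(R)$ and whenever $a,b\in R$ with $0\neq ab\in I$, then $a\in J(I)$ or $b\in I$.
   Context: $J(R)$ denotes the Jacobson radical of $R$. For a proper ideal $I$ of $R$, $J(I)$ denotes the intersection of all maximal ideals of $R$ containing $I$. A proper ideal $I$ of $R$ is a weakly $J$-ideal if whenever $a,b\in R$ with $0\neq ab\in I$ and $a\notin J(R)$, then $b\in I$. *)

(* Defs.v *)
From mathcomp Require Import all_boot all_algebra.
From mathcomp Require Import boolp classical_sets.

Set Implicit Arguments.
Unset Strict Implicit.
Unset Printing Implicit Defensive.

Import GRing.Theory.
Local Open Scope ring_scope.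
Local Open Scope classical_set_scope.

(* Ideals are arbitrary (classical) subsets, not only decidable ones.
   [idealr_closed] includes 1 \notin I, so it already means "proper ideal". *)
Definition is_proper_ideal (R : comNzRingType) (I : set R) : Prop :=
  idealr_closed [in I].

Definition is_maximal_ideal (R : comNzRingType) (M : set R) : Prop :=
  is_proper_ideal M /\
  forall N : set R, is_proper_ideal N -> M `<=` N -> N = M.

Definition jacobson_radical (R : comNzRingType) : set R :=
  \bigcap_(M in [set M : set R | is_maximal_ideal M]) M.

Arguments jacobson_radical : clear implicits.

Definition jacobson_over (R : comNzRingType) (I : set R) : set R :=
  \bigcap_(M in [set M : set R | is_maximal_ideal M /\ I `<=` M]) M.

Definition is_weakly_J_ideal (R : comNzRingType) (I : set R) : Prop :=
  is_proper_ideal I /\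
  forall a b : R, a * b <> 0 -> I (a * b) -> ~ jacobson_radical R a -> I b.

(* Main.v *)
Require Import Defs.
From mathcomp Require Import all_boot all_algebra.
From mathcomp Require Import boolp classical_sets.

Import GRing.Theory.
Local Open Scope ring_scope.
Local Open Scope classical_set_scope.

(** Once [I] lies in J(R), J(I) and J(R) coincide, so the two conditions on products differ only by
    a classical case split on whether [a] is in J(R). What remains is that a weakly J-ideal lies in
    J(R), which is [weakly_J_ideal_sub_radical]. *)

Lemma proper_ideal0 (R : comNzRingType) (I : set R) : is_proper_ideal I -> I 0.
Proof. by case=> /set_mem. Qed.

Lemma proper_ideal_not1 (R : comNzRingType) (I : set R) :
  is_proper_ideal I -> ~ I 1.
Proof. by case=> _ I1 _ /mem_set; apply/negP. Qed.

Lemma jacobson_radical0 (R : comNzRingType) : jacobson_radical R 0.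
Proof. by move=> M [/proper_ideal0]. Qed.

Lemma jacobson_radical_sub_over (R : comNzRingType) (I : set R) :
  jacobson_radical R `<=` jacobson_over I.
Proof. by move=> a Ja M [maxM _]; apply: Ja. Qed.

(** Every maximal ideal contains J(R), hence [I], so both intersections run over the same family. *)
Lemma jacobson_over_sub_radical (R : comNzRingType) (I : set R) :
  I `<=` jacobson_radical R -> jacobson_over I `<=` jacobson_radical R.
Proof. by move=> IJ a Ja M maxM; apply: Ja; split=> // x /IJ; apply. Qed.

Lemma weakly_J_ideal_sub_radical (R : comNzRingType) (I : set R) :
  is_weakly_J_ideal I -> I `<=` jacobson_radical R.
Proof.
move=> [hI wJ] a Ia; apply: contrapT => nJa.
(* The factorization [a = a * 1] forces [1] into [I] when [a] is outside J(R). *)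
apply: (proper_ideal_not1 R I hI); apply: (wJ a 1); rewrite ?mulr1 //.
(* The product is nonzero because [0] lies in J(R) and [a] does not. *)
by move=> a0; apply: nJa; rewrite a0; apply: jacobson_radical0.
Qed.

Theorem proposition1 (R : comNzRingType) (I : set R) (hI : is_proper_ideal I) :
  is_weakly_J_ideal I <->
  (I `<=` jacobson_radical R /\
   forall a b : R, a * b <> 0 -> I (a * b) -> jacobson_over I a \/ I b).
Proof.
split=> [wJI | [IJ h]].
  split=> [|a b ab0 Iab]; first exact: weakly_J_ideal_sub_radical.
  have [Ja|nJa] := pselect (jacobson_radical R a).
    by left; apply: jacobson_radical_sub_over.
  by right; apply: wJI.2 ab0 Iab nJa.
split=> // a b ab0 Iab nJa.
by have [/(jacobson_over_sub_radical R I IJ)|] := h a b ab0 Iab.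
Qed.
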